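(* Let $T$ be a tree on $n$ vertices and let $j$ be a positive integer. Then the number $\mathrm{sink}(T,j)$ of acyclic orientations of $T$ with exactly $j$ sinks is \[ \mathrm{sink}(T,j) = \sum_{\substack{\lambda \vdash n \\ \ell(\lambda)=j}}\ \sum_{\mu \dashv \lambda} (-1)^{j-\ell(\mu)}\, b_{\mu}\,w(B_{\lambda,\mu}), \] where $b_\mu$ is the number of connected partitions of $T$ of type $\mu$.
   Context: An acyclic orientation of a graph is an orientation of its edges with no directed cycle; a sink is a vertex with no arcs pointing out of it. Partitions: $\lambda\vdash n$ means $\lambda$ is an integer partition of $n$ (order of parts is irrelevant); $\ell(\lambda)$ is its number of parts. Write $\mu\dashv\lambda$ if $\lambda$ is a refinement of $\mu$, i.e. $\lambda$ can be obtained from $\mu$ by splitting parts of $\mu$ (possibly splitting none, so $\mu=\lambda$ is included). Connected partitions: a connected partition of a graph $G$ is a set partition $\{B_1,\dots,B_k\}$ of $V(G)$ such that each $B_i$ induces a connected subgraph; its type is the integer partition formed by $|B_1|,\dots,|B_k|$. $b_\mu$ is the number of connected partitions of type $\mu$. Brick tabloids: a brick tabloid of shape $\mu$ and content $\lambda$ is the Young diagram of $\mu$ (with $\mu_i$ left-justified boxes in the $i$-th row) with each row divided into bricks, each brick consisting of one or more consecutive boxes of that row, such that the multiset of lengths of all bricks is the multiset of parts of $\lambda$. $B_{\lambda,\mu}$ is the set of all such brick tabloids. The weight $w(T')$ of a brick tabloid $T'$ is the product over its rows of the length of the last (rightmost) brick in the row, and $w(B_{\lambda,\mu})=\sum_{T'\in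 B_{\lambda,\mu}}w(T')$. *)

(* Defs.v *)
From HB Require Import structures.
From mathcomp Require Import all_boot all_order all_algebra.

Set Implicit Arguments.
Unset Strict Implicit.
Unset Printing Implicit Defensive.

(* A simple graph on V is a symmetric irreflexive relation e : rel V. *)
Section Graphs.
Variables (V : finType) (e : rel V).

(* In a simple graph a duplicate-free closed e-walk of size 2 is a single edge
   traversed back and forth; the genuine cycles are those of size at least 3. *)
Definition is_tree : Prop :=
  [/\ symmetric e, irreflexive e, 0 < #|V|,
      forall x y : V, connect e x y &
      forall c : seq V, ucycle e c -> size c <= 2].

Definition induced (B : {set V}) : rel V :=
  [rel x y | [&& x \in B, y \in B & e x y]].

Definition connected_in (B : {set V}) : bool :=
  [forall x in B, forall y in B, connect (induced B) x y].

(* The blocks of a mathcomp [partition] are nonempty. *)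
Definition connected_partition (P : {set {set V}}) : bool :=
  partition P [set: V] && [forall B in P, connected_in B].

Definition has_type (P : {set {set V}}) (mu : seq nat) : bool :=
  perm_eq [seq #|B| | B : {set V} in P] mu.

Definition num_connected_partitions (mu : seq nat) : nat :=
  #|[set P : {set {set V}} | connected_partition P && has_type P mu]|.

(* A set D of ordered pairs is read as a set of arcs: (x, y) \in D is an arc
   pointing from x to y. *)
Definition arc (D : {set V * V}) : rel V := [rel x y | (x, y) \in D].

Definition orientation (D : {set V * V}) : bool :=
  [forall x, forall y,
     if e x y then arc D x y (+) arc D y x else ~~ arc D x y].

(* A decidable form of the absence of directed cycles; see acyclicP. *)
Definition acyclic (D : {set V * V}) : bool :=
  [forall x, forall y, arc D x y ==> ~~ connect (arc D) y x].

Lemma acyclicP (D : {set V * V}) :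
  reflect (forall c : seq V, cycle (arc D) c -> c = [::]) (acyclic D).
Proof.
apply: (iffP forallP) => [acD [|x c] //= |noc x].
- case: c => [|y c] /=.
    by move=> /andP[xx _]; have /forallP/(_ x) := acD x; rewrite xx connect0.
  move=> /andP[xy]; rewrite rcons_path => /andP[yc cx].
  have /forallP/(_ y) := acD x; rewrite xy /= => /negP[].
  apply: (@connect_trans _ _ (last y c)); last exact: connect1.
  by apply/connectP; exists c.
- apply/forallP => y; apply/implyP => xy; apply/negP => /connectP[p yp xl].
  by have /noc: cycle (arc D) (y :: p) by rewrite /= rcons_path yp -xl.
Qed.

Definition sinks (D : {set V * V}) : {set V} :=
  [set x | [forall y, ~~ arc D x y]].

Definition num_sink_orientations (j : nat) : nat :=
  #|[set D : {set V * V} |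
      [&& orientation D, acyclic D & #|sinks D| == j]]|.

End Graphs.

Definition is_intpart (n : nat) (s : seq nat) : bool :=
  [&& sorted geq s, 0 \notin s & sumn s == n].

Lemma size_le_sumn (s : seq nat) : 0 \notin s -> size s <= sumn s.
Proof.
elim: s => //= x s IHs; rewrite inE negb_or eq_sym -lt0n => /andP[x0 /IHs].
exact: (@leq_add 1).
Qed.

Lemma mem_le_sumn (s : seq nat) x : x \in s -> x <= sumn s.
Proof.
elim: s => //= y s IHs; rewrite inE => /predU1P[->|/IHs xs].
  exact: leq_addr.
exact: leq_trans xs (leq_addl _ _).
Qed.

(* The size and entry bounds only serve to make this a finite type; see
   intpart_surj. *)
Record intpart (n : nat) := IntPart {
  intpart_bseq : n.-bseq 'I_n.+1;
  _ : is_intpart n (map val intpart_bseq) }.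

HB.instance Definition _ n := [isSub for @intpart_bseq n].
HB.instance Definition _ n := [Finite of intpart n by <:].

Coercion parts (n : nat) (p : intpart n) : seq nat := map val (intpart_bseq p).

Lemma parts_inj n : injective (@parts n).
Proof. by move=> p q /(inj_map val_inj) /val_inj /val_inj. Qed.

Lemma partsP n (p : intpart n) : is_intpart n p.
Proof. by case: p. Qed.

Lemma bounded_bseq (m n : nat) (s : seq nat) :
  size s <= n -> (forall x, x \in s -> x <= m) ->
  exists b : n.-bseq 'I_m.+1, map val b = s.
Proof.
move=> sn sm.
have sb : size (map (@inord m) s) <= n by rewrite size_map.
exists (Bseq sb); rewrite /= -map_comp -[RHS]map_id.
by apply/eq_in_map => x /sm xm /=; rewrite inordK.
Qed.

Lemma intpart_surj n (s : seq nat) :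
  is_intpart n s -> exists p : intpart n, parts p = s.
Proof.
move=> ps; have /and3P[_ s0 /eqP sn] := ps.
have [||b bs] := @bounded_bseq n n s.
- by rewrite -[X in _ <= X]sn size_le_sumn.
- by move=> x /mem_le_sumn; rewrite sn.
have pb : is_intpart n (map val b) by rewrite bs.
by exists (IntPart pb).
Qed.

(* Candidate fillings of the rows of the Young diagram of mu: the i-th entry is
   the left-to-right list of brick lengths in row i. The bounds only serve to
   make this a finite type; see filling_surj. *)
Definition filling (mu : seq nat) : finType :=
  (size mu).-tuple ((sumn mu).-bseq 'I_(sumn mu).+1).

Definition rows (mu : seq nat) (t : filling mu) : seq (seq nat) :=
  [seq map val r | r : _.-bseq _ <- t].

(* Each part of mu is cut, in order, into a list of positive parts, and the
   pieces together form the multiset lam. *)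
Definition cuts (lam mu : seq nat) (t : seq (seq nat)) : bool :=
  [&& map sumn t == mu, 0 \notin flatten t & perm_eq (flatten t) lam].

Lemma rows_inj mu : injective (@rows mu).
Proof.
move=> t u tu; apply/val_inj; apply: inj_map tu => r r' rr'.
by apply/val_inj; apply: inj_map rr'; apply: val_inj.
Qed.

Lemma filling_surj (lam mu : seq nat) (t : seq (seq nat)) :
  cuts lam mu t -> exists u : filling mu, rows u = t.
Proof.
move=> /and3P[/eqP tmu t0 _].
have rowP r : r \in t ->
    exists b : (sumn mu).-bseq 'I_(sumn mu).+1, map val b == r.
  move=> rt; have rmu : sumn r <= sumn mu.
    by apply: mem_le_sumn; rewrite -tmu map_f.
  have r0 : 0 \notin r.
    by apply: contra t0 => r0; apply/flattenP; exists r.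
  have [||b <-] := @bounded_bseq (sumn mu) (sumn mu) r; last by exists b.
    exact: leq_trans (size_le_sumn r0) rmu.
  by move=> x /mem_le_sumn xr; apply: leq_trans xr rmu.
pose g r := odflt [bseq] [pick b : (sumn mu).-bseq 'I_(sumn mu).+1
                         | map val b == r].
have gK r : r \in t -> map val (g r) = r.
  move=> /rowP[b br]; rewrite /g; case: pickP => [c /eqP //|/(_ b)].
  by rewrite br.
have st : size (map g t) == size mu by rewrite size_map -(size_map sumn) tmu.
exists (Tuple st); rewrite /rows /= -map_comp -[RHS]map_id.
by apply/eq_in_map => r /gK.
Qed.

(* refines mu lam: lam is a refinement of mu. *)
Definition refines (mu lam : seq nat) : bool :=
  [exists t : filling mu, cuts lam mu (rows t)].

Lemma refinesP (mu lam : seq nat) :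
  reflect (exists t, cuts lam mu t) (refines mu lam).
Proof.
apply: (iffP existsP) => [[t ct]|[t ct]]; first by exists (rows t).
by have [u ut] := filling_surj ct; exists u; rewrite ut.
Qed.

(* Tabloids of shape mu and content lam: B_{lam,mu}. *)
Definition brick_tabloids (lam mu : seq nat) : {set filling mu} :=
  [set t | cuts lam mu (rows t)].

Definition weight (mu : seq nat) (t : filling mu) : nat :=
  \prod_(r <- rows t) last 0 r.

Definition brick_weight (lam mu : seq nat) : nat :=
  \sum_(t in brick_tabloids lam mu) weight t.

Lemma refines_size (mu lam : seq nat) :
  0 \notin mu -> refines mu lam -> size mu <= size lam.
Proof.
move=> mu0 /refinesP[t /and3P[/eqP tmu _ /perm_size <-]].
rewrite -tmu in mu0 *; rewrite size_map {tmu}.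
elim: t mu0 => //= r t IHt; rewrite inE negb_or => /andP[r0 /IHt].
by case: r r0 => //= x r _ st; rewrite size_cat ltnS (leq_trans st) ?leq_addl.
Qed.

(* Main.v *)
Require Import Defs.
From HB Require Import structures.
From mathcomp Require Import all_boot all_order all_algebra.

Set Implicit Arguments.
Unset Strict Implicit.
Unset Printing Implicit Defensive.

Import GRing.Theory Num.Theory.
Local Open Scope ring_scope.

(** Everything is compared through the polynomial identity, in [y = 1 - X],
      [sum_O (1 - y)^(number of sinks of O)
         = sum_P prod_(B in P) (1 - y^|B|)],
    where [O] runs over the acyclic orientations of the tree and [P] over its
    connected partitions; the theorem is the coefficient of [X^j].

    Bricks turn up on the right because the total weight of the tabloids of
    shape [mu] with [j] bricks is the coefficient of [X^j] in
    [prod_i ((1 + X)^mu_i - 1)]: marking one box in the last brick of a row and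
    the last box of every other brick of that row encodes a row cut into [k]
    bricks, with its weight, by a [k]-subset of its boxes. So a row of length
    [m] contributes [(1 + X)^m - 1] ([sum_last_compositions]), and substituting
    [- X] for [X] makes the signs (-1)^(j - l(mu)) appear ([coef_prod_bricks]).

    Both sides of the identity are sums over sets [A] of edges. In a tree every
    orientation is acyclic, and an orientation is a set of edges as soon as a
    reference direction is chosen for every edge. A connected partition is the
    set of components of the subgraph formed by the edges inside its blocks, and
    in a tree this edge set can be arbitrary ([sum_connected_partitions]): two
    adjacent vertices that are connected within a set of edges are joined by an
    edge of this set ([tree_connect]).

    Now expand both sides in powers of [y], and fix the set [W] of vertices that
    contribute to the exponent. On the left, [W] consists of sinks, which is a
    condition on each edge separately: its arc must not leave [W]. On the right,
    [W] is a union of components of [A], counted with the sign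
    (-1)^(number of components in [W]). Since [A] is a forest, this number is
    |W| minus the number of edges of [A] inside [W]
    ([card_components_inside]), so the sign too is a product over edges.
    Summing over [A] therefore gives, on both sides, [(- y)^|W|] times a product
    over all edges of the tree, and in both cases the factor of an edge is the
    number of its endpoints outside [W] ([sum_orientations_sinks],
    [sum_connected_partitions_blocks]). *)

(** * Expanding products over subsets *)

Lemma prod_add_subsets (R : comPzRingType) (I : finType) (E : {set I})
    (F G : I -> R) :
  \prod_(i in E) (F i + G i) =
  \sum_(A : {set I} | A \subset E)
     \prod_(i in E) (if i \in A then F i else G i).
Proof.
have -> : \prod_(i in E) (F i + G i) =
    \prod_i ((if i \in E then F i else 0) + (if i \in E then G i else 1)).
  rewrite big_mkcond; apply: eq_bigr => i _.
  by case: ifP => // _; rewrite add0r.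
rewrite bigA_distr [LHS]/= (bigID (fun A : {set I} => A \subset E)) /=.
rewrite [X in _ + X]big1 ?addr0 => [|A /subsetPn[i iA iE]].
  apply: eq_bigr => A /subsetP AE.
  rewrite [RHS]big_mkcond; apply: eq_bigr => i _.
  by case: ifP => // /AE ->.
by rewrite (bigD1 i) //= iA (negPf iE) mul0r.
Qed.

Lemma prod_one_add_subsets (R : comPzRingType) (I : finType) (E : {set I})
    (F : I -> R) :
  \prod_(i in E) (1 + F i) =
  \sum_(A : {set I} | A \subset E) \prod_(i in A) F i.
Proof.
under eq_bigr do rewrite addrC.
rewrite prod_add_subsets; apply: eq_bigr => A /subsetP AE.
rewrite -big_mkcondr; apply: eq_bigl => i.
by rewrite andb_idl // => /AE.
Qed.

Lemma prod_indicator (R : comPzRingType) (I : finType) (E : {set I})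
    (P : pred I) :
  \prod_(i in E) (P i)%:R = [forall i in E, P i]%:R :> R.
Proof.
have [/forall_inP PE|] := boolP [forall i in E, P i].
  by rewrite big1 // => i /PE ->.
rewrite negb_forall => /existsP[i]; rewrite negb_imply => /andP[iE /negPf nPi].
by rewrite (bigD1 i) //= nPi mul0r.
Qed.

(** * Brick tabloids *)

(** The compositions of [k.+1]. The recursion prepends a brick of length one or
    lengthens the first brick; the last brick keeps its length except when it is
    also the first, which makes its length easy to sum. *)
Fixpoint compositions (k : nat) : seq (seq nat) :=
  if k is k'.+1 then
    [seq 1%N :: c | c <- compositions k'] ++
    [seq (head 0%N c).+1 :: behead c | c <- compositions k']
  else [:: [:: 1%N]].

Lemma mem_compositions k c :
  (c \in compositions k) = (sumn c == k.+1) && (0%N \notin c).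
Proof.
elim: k c => [|k IHk] c /=.
  by rewrite inE; case: c => [|[|[|x]] [|[|y] c]]; rewrite /= ?andbF.
rewrite mem_cat; apply/idP/idP => [/orP[]/mapP[d]|].
- by rewrite IHk => /andP[/eqP sd d0] ->; rewrite /= sd add1n eqxx inE.
- rewrite IHk; case: d => [|x d] //= /andP[/eqP sd].
  by rewrite inE negb_or => /andP[_ d0] ->; rewrite /= addSn sd eqxx inE.
case: c => [|[|[|x]] c] //=.
- by rewrite andbF.
- rewrite add1n eqSS inE /= => cP; apply/orP; left.
  by apply/mapP; exists c => //; rewrite IHk.
- rewrite addSn eqSS inE /= => cP; apply/orP; right.
  by apply/mapP; exists (x.+1 :: c) => //; rewrite IHk inE.
Qed.

Lemma uniq_compositions k : uniq (compositions k).
Proof.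
elim: k => //= k IHk; rewrite cat_uniq; apply/and3P; split.
- by rewrite map_inj_uniq // => c d [].
- apply/hasPn => _ /mapP[d dk ->]; apply/mapP => -[c _ [d0 _]].
  move: dk; rewrite mem_compositions; case: d d0 => //= x d ->.
  by rewrite inE eqxx andbF.
rewrite map_inj_in_uniq // => c d.
rewrite !mem_compositions; case: c => [|x c]//; case: d => [|y d]//= _ _.
by move=> [-> ->].
Qed.

Lemma big_compositionsS (R : nmodType) (F : seq nat -> R) k :
  \sum_(c <- compositions k.+1) F c =
  \sum_(c <- compositions k) (F (1%N :: c) + F ((head 0%N c).+1 :: behead c)).
Proof. by rewrite big_cat !big_map big_split. Qed.

(** The compositions with a single brick are the ones whose last brick grows in
    the recursion defining [compositions]; this is the resulting correction term
    in [sum_last_compositions]. *)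
Lemma sum_compositions_one_brick (R : comPzRingType) (x : R) k :
  \sum_(c <- compositions k) (size c == 1%N)%:R * x ^+ size c = x.
Proof.
elim: k => [|k IHk]; first by rewrite big_seq1 mul1r.
rewrite big_compositionsS -[RHS]IHk big_seq [RHS]big_seq.
apply: eq_bigr => -[|a c]; rewrite mem_compositions //= => _.
by rewrite mul0r add0r.
Qed.

(** The coefficient of [x ^+ i] on the left, for [i] positive, is the number
    ['C(k.+1, i)] of sets of [i] boxes in a row of length [k.+1]: such a set
    consists of the last box of every brick but the last, and of one box of the
    last brick. The algebraic proof follows the recursion: if [G m] is the sum
    for the compositions of [m], then [G m.+1 = x * G m + (G m + x)]. *)
Lemma sum_last_compositions (R : comPzRingType) (x : R) k :
  \sum_(c <- compositions k) (last 0%N c)%:R * x ^+ size c =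
  (1 + x) ^+ k.+1 - 1.
Proof.
elim: k => [|k IHk]; first by rewrite big_seq1 mul1r addrC addKr.
have -> : (1 + x) ^+ k.+2 - 1 = (1 + x) * ((1 + x) ^+ k.+1 - 1) + x.
  by rewrite mulrBr mulr1 -exprS opprD addrA subrK.
rewrite -IHk -[X in _ + X](sum_compositions_one_brick x k) big_compositionsS.
rewrite mulr_sumr -big_split big_seq [RHS]big_seq.
apply: eq_bigr => -[|a c]; rewrite mem_compositions //= => _.
have -> : (last a.+1 c)%:R = (last a c)%:R + (size c == 0%N)%:R :> R.
  by case: c => [|b c] /=; rewrite ?addr0 // -addn1 natrD.
rewrite [x ^+ _.+2]exprS !mulrDl mul1r addrA mulrCA; congr (_ + _).
by rewrite addrC.
Qed.

(** Passes from the rows of a filling, which live in a finite type bounded by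
    [N], to the explicit list of compositions. *)
Lemma sum_bseq_compositions (R : nmodType) (F : seq nat -> R) N k :
  (k < N)%N ->
  \sum_(r : N.-bseq 'I_N.+1 |
        (sumn (map val r) == k.+1) && (0%N \notin map val r)) F (map val r) =
  \sum_(c <- compositions k) F c.
Proof.
move=> kN.
have val2_inj : injective (fun r : N.-bseq 'I_N.+1 => map val r).
  by move=> r s rs; apply/val_inj; apply: inj_map rs; apply: val_inj.
rewrite -[LHS]big_filter -(big_map _ xpredT F).
apply: perm_big; apply: uniq_perm (uniq_compositions k) _.
  by rewrite map_inj_uniq // filter_uniq // index_enum_uniq.
move=> c; rewrite mem_compositions; apply/mapP/idP => [[r]|cP].
  by rewrite mem_filter => /andP[rP _] ->.
have /andP[/eqP sc c0] := cP.
have [||r rc] := @bounded_bseq N N c.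
- by apply: leq_trans (size_le_sumn c0) _; rewrite sc.
- by move=> y /mem_le_sumn yc; apply: leq_trans yc _; rewrite sc.
by exists r; rewrite // mem_filter mem_index_enum rc cP.
Qed.

(** The rows of a tabloid are cut independently of each other, and both the
    weight and the monomial are multiplicative over rows. *)
Lemma sum_fillings (R : comPzRingType) (x : R) (mu : seq nat) :
  0%N \notin mu ->
  \sum_(t : filling mu | (map sumn (rows t) == mu)
                         && (0%N \notin flatten (rows t)))
     (weight t)%:R * x ^+ size (flatten (rows t)) =
  \prod_(m <- mu) ((1 + x) ^+ m - 1).
Proof.
move=> mu0; set N := sumn mu; pose row := (N.-bseq 'I_N.+1)%type.
pose Q i (r : row) :=
  (sumn (map val r) == tnth (in_tuple mu) i) && (0%N \notin map val r).
pose w (r : row) : R := (last 0%N (map val r))%:R * x ^+ size r.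
transitivity (\prod_(i < size mu) \sum_(r | Q i r) w r); last first.
  rewrite [RHS]big_tnth; apply: eq_bigr => i _.
  rewrite /Q; set m := tnth _ i; have mmu : m \in mu by apply: mem_tnth.
  case E : m => [|k]; first by rewrite -E mmu in mu0.
  have /(sum_bseq_compositions (fun c => (last 0%N c)%:R * x ^+ size c)) :
      (k < N)%N.
    by rewrite -E mem_le_sumn.
  rewrite sum_last_compositions => <-.
  by apply: eq_bigr => r _; rewrite size_map.
rewrite bigA_distr_big_dep /=.
pose tup (f : {ffun 'I_(size mu) -> row}) : filling mu :=
  [tuple f i | i < size mu].
rewrite (reindex tup) /=; last first.
  exists (fun t => [ffun i => tnth t i]) => [f _|t _].
    by apply/ffunP => i; rewrite ffunE tnth_mktuple.
  by apply: eq_from_tnth => i; rewrite tnth_mktuple ffunE.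
have rowsE f : rows (tup f) = [seq map val (f i) | i <- enum 'I_(size mu)].
  by rewrite /rows -map_comp.
apply: eq_big => [f|f _].
  rewrite rowsE; apply/andP/familyP => [[/eqP smu f0] i|fQ].
  - apply/andP; split; last first.
      apply: contra f0 => f0; apply/flattenP; exists (map val (f i)) => //.
      by apply/mapP; exists i; rewrite ?mem_enum.
    have /(congr1 (nth 0%N ^~ i)) := smu; rewrite (tnth_nth 0%N) /= => <-.
    by rewrite -map_comp (nth_map i) ?size_enum_ord //= nth_ord_enum.
  split; last first.
    apply/negP => /flattenP[_ /mapP[i _ ->]].
    by apply/negP; case/andP: (fQ i).
  apply/eqP; rewrite -map_comp -[RHS]/(tval (in_tuple mu)).
  rewrite -[RHS](map_tnth_enum (in_tuple mu)).
  by apply: eq_map => i /=; case/andP: (fQ i) => /eqP.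
rewrite /weight rowsE big_map natr_prod big_enum /=.
rewrite big_split /=; congr (_ * _).
rewrite size_flatten /shape -map_comp sumnE big_map big_enum /=.
rewrite -expr_sum.
by congr (_ ^+ _); apply: eq_bigr => i _; rewrite size_map.
Qed.

(** A multiset of positive integers is listed by exactly one partition, its
    decreasing rearrangement. *)
Lemma intpart_of_perm n (s : seq nat) :
  0%N \notin s -> sumn s = n ->
  exists p : intpart n, forall q : intpart n, perm_eq s q = (q == p).
Proof.
move=> s0 sn.
have leT : total geq by move=> a b; apply: leq_total.
have leA : antisymmetric geq by move=> a b; rewrite andbC; apply: anti_leq.
have leTr : transitive geq by move=> a b c /= ab ca; apply: leq_trans ca ab.
have [|p pE] := @intpart_surj n (sort geq s).
  rewrite /is_intpart sort_sorted // mem_sort s0 -sn.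
  by rewrite (perm_sumn (permEl (perm_sort _ _))) eqxx.
exists p => q; apply/idP/eqP => [sq|->]; last by rewrite pE perm_sym perm_sort.
apply: (@parts_inj n); rewrite pE.
have /and3P[qs _ _] := partsP q.
apply: (sorted_eq leTr leA qs (sort_sorted leT _)).
by rewrite perm_sym perm_sort.
Qed.

Lemma sum_brick_weight n (mu : intpart n) j :
  (\sum_(lam : intpart n | size lam == j) brick_weight lam mu =
   \sum_(t : filling mu | [&& map sumn (rows t) == mu,
       0 \notin flatten (rows t) & size (flatten (rows t)) == j]) weight t)%N.
Proof.
rewrite /brick_weight (exchange_big_dep predT) //= [RHS]big_mkcond /=.
apply: eq_bigr => t _; under eq_bigl => lam do rewrite inE.
have [/and3P[smu t0 st]|ntP] := ifPn; last first.
  rewrite big_pred0 // => lam; apply/negP => /andP[/eqP lj /and3P[smu t0 tlam]].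
  by case/negP: ntP; rewrite smu t0 (perm_size tlam) lj eqxx.
have [|p pP] := intpart_of_perm t0 (n := n).
  by rewrite sumn_flatten (eqP smu); have /and3P[_ _ /eqP] := partsP mu.
rewrite (big_pred1 p) // => lam; rewrite /cuts smu t0 pP /=.
by rewrite andb_idl // -pP => /perm_size <-.
Qed.

(** [sum_fillings] at [- 'X]: the [j] bricks give the sign [(-1) ^+ j], and
    reversing the [size mu] factors gives [(-1) ^+ size mu]. *)
Lemma coef_prod_bricks n (mu : intpart n) j :
  (\prod_(m <- parts mu) (1 - (1 - 'X) ^+ m) : {poly int})`_j =
  \sum_(lam : intpart n | (size lam == j) && refines mu lam)
     (-1) ^+ (j - size mu) * (brick_weight lam mu)%:Z.
Proof.
have mu0 : 0%N \notin parts mu by have /and3P[] := partsP mu.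
transitivity ((-1) ^+ (size mu + j) *
    \sum_(lam : intpart n | size lam == j) (brick_weight lam mu)%:Z); last first.
  rewrite mulr_sumr [RHS]big_mkcondr; apply: eq_bigr => lam /eqP lj.
  have [muj|nref] := ifPn.
    congr (_ * _); rewrite -[j in LHS](subnK (_ : size mu <= j)%N).
      by rewrite addnCA exprD addnn -mul2n exprM sqrrN !expr1n mulr1.
    by rewrite -lj refines_size.
  rewrite /brick_weight big_pred0 ?mulr0 // => t; rewrite inE.
  by apply/negP => /(introT (refinesP _ _) \o ex_intro _ (rows t)); apply/negP.
have -> : \prod_(m <- parts mu) (1 - (1 - 'X) ^+ m) =
    (-1) ^+ size mu * \prod_(m <- parts mu) ((1 - 'X) ^+ m - 1) :> {poly int}.
  rewrite -count_predT -iter_mulr_1 -big_const_seq -big_split /=.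
  by apply: eq_bigr => m _; rewrite mulN1r opprB.
rewrite -(sum_fillings _ mu0) -(big_morph Posz PoszD erefl) sum_brick_weight.
rewrite (big_morph Posz PoszD erefl) exprD -mulrA.
have coef_sign k (p : {poly int}) : ((-1) ^+ k * p)`_j = (-1) ^+ k * p`_j.
  by elim: k => [|k IHk]; rewrite ?mul1r // !exprS -!mulrA !mulN1r coefN IHk.
rewrite coef_sign; congr (_ * _).
rewrite coef_sum mulr_sumr big_mkcond [RHS]big_mkcond.
apply: eq_bigr => t _; rewrite andbA; case: ifP => //= _.
rewrite mulr_natl coefMn [(- 'X) ^+ _]exprNn coef_sign coefXn eq_sym.
case: eqP => [->|_]; first by rewrite mulr1 -mulr_natr natz.
by rewrite mulr0 mul0rn.
Qed.

(** * Unions of blocks of a set partition *)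

(** If [W] is a union of blocks of [P], then it is the union of all the blocks
    inside [W]; this makes the property decidable. *)
Definition saturated (T : finType) (P : {set {set T}}) (W : {set T}) : bool :=
  cover [set B in P | B \subset W] == W.

(** Expanding the product chooses a set of blocks; it is recorded by the union
    [W] of the chosen blocks, from which it is recovered as the set of the
    blocks inside [W]. *)
Lemma prod_blocks_saturated (R : comPzRingType) (y : R) (T : finType)
    (P : {set {set T}}) :
  partition P [set: T] ->
  \prod_(B in P) (1 - y ^+ #|B|) =
  \sum_(W | saturated P W) (-1) ^+ #|[set B in P | B \subset W]| * y ^+ #|W|.
Proof.
case/and3P=> _ tiP P0; rewrite prod_one_add_subsets.
rewrite (reindex_onto (fun W : {set T} => [set B in P | B \subset W]) cover) /=;
  last first.
  move=> C CP; apply/setP => B; rewrite inE; apply/andP/idP => [[BP BC]|BC].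
    have [B0|[x xB]] := set_0Vmem B; first by rewrite -B0 BP in P0.
    have /bigcupP[B' B'C xB'] := subsetP BC x xB.
    rewrite -(def_pblock tiP BP xB) (def_pblock tiP _ xB') //.
    exact: (subsetP CP).
  by split; [apply: (subsetP CP) | apply: (bigcup_sup B)].
apply: eq_big => [W|W /andP[_ /eqP WE]].
  by rewrite andb_idl // => _; apply/subsetP => B; rewrite inE => /andP[].
rewrite prodrN; congr (_ * _); rewrite prodrXr; congr (_ ^+ _).
rewrite -[in RHS]WE; apply/eqP; apply: trivIsetS tiP.
by apply/subsetP => B; rewrite inE => /andP[].
Qed.

(** * Components of a set of edges *)

Section Edges.
Variables (V : finType) (e : rel V).

(** Every edge appears once, in an arbitrary reference direction, so that both
    orientations and subgraphs are encoded by subsets of [edges]. *)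
Definition edges : {set V * V} :=
  [set f | e f.1 f.2 && (enum_rank f.1 < enum_rank f.2)%N].

Definition adj (A : {set V * V}) : rel V :=
  fun x y => ((x, y) \in A) || ((y, x) \in A).

Lemma adj_sym A : symmetric (adj A).
Proof. by move=> x y; rewrite /adj orbC. Qed.

Definition component (A : {set V * V}) (x : V) : {set V} :=
  [set y | connect (adj A) x y].

Lemma mem_component A x : x \in component A x.
Proof. by rewrite inE connect0. Qed.

Lemma eq_component A x y :
  (component A x == component A y) = connect (adj A) x y.
Proof.
have csym := sym_connect_sym (@adj_sym A).
apply/eqP/idP => [cxy|cxy].
  by have := mem_component A y; rewrite -cxy inE.
by apply/setP => z; rewrite !inE (same_connect csym cxy).
Qed.

(** The closure condition is stated on the arcs as they appear in [A]; it is an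
    equality, so it takes care of both directions. *)
Lemma component_min (A : {set V * V}) (S : {set V}) x :
  x \in S ->
  (forall f, f \in A -> (f.1 \in S) = (f.2 \in S)) -> component A x \subset S.
Proof.
move=> xS Sclosed; apply/subsetP => y; rewrite inE => cxy.
by rewrite -(closed_connect _ cxy) // => z w /orP[] /Sclosed.
Qed.

Lemma component_closed (A : {set V * V}) x f :
  f \in A -> (f.1 \in component A x) = (f.2 \in component A x).
Proof.
case: f => u v fA; have uv : connect (adj A) u v.
  by apply: connect1; rewrite /adj fA.
rewrite !inE /=; apply/idP/idP => c; apply: connect_trans c _ => //.
by rewrite (sym_connect_sym (@adj_sym A)).
Qed.

Definition components A : {set {set V}} := component A @: [set: V].

Lemma mem_components A x : component A x \in components A.
Proof. exact: imset_f. Qed.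

Lemma components_partition A : partition (components A) [set: V].
Proof.
apply/and3P; split.
- apply/eqP/setP => x; rewrite inE; apply/bigcupP.
  by exists (component A x); rewrite ?mem_components ?mem_component.
- apply/trivIsetP => _ _ /imsetP[x _ ->] /imsetP[y _ ->].
  apply: contraR => /pred0Pn[z /andP[]] /=; rewrite !inE => xz yz.
  rewrite eq_component (connect_trans xz) //.
  by rewrite (sym_connect_sym (@adj_sym A)).
- apply/imsetP => -[x _ /setP/(_ x)].
  by rewrite mem_component inE.
Qed.

Lemma components_inside (A : {set V * V}) (W : {set V}) :
  (forall f, f \in A -> (f.1 \in W) = (f.2 \in W)) ->
  [set B in components A | B \subset W] = component A @: W.
Proof.
move=> WA; apply/setP => B; rewrite inE; apply/andP/imsetP.
  move=> [/imsetP[x _ ->] /subsetP xW]; exists x => //.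
  by apply: xW; apply: mem_component.
by move=> [x xW ->]; rewrite mem_components component_min.
Qed.

Lemma saturated_components (A : {set V * V}) (W : {set V}) :
  reflect (forall f, f \in A -> (f.1 \in W) = (f.2 \in W))
          (saturated (components A) W).
Proof.
apply: (iffP eqP) => [<- f fA|WA].
  apply/bigcupP/bigcupP => -[B]; rewrite inE => /andP[BA BW] fB; exists B;
    rewrite ?inE ?BA ?BW //; have /imsetP[x _ Bx] := BA.
    by rewrite Bx -(component_closed _ fA) -?Bx.
  by rewrite Bx (component_closed _ fA) -?Bx.
apply/setP => x; rewrite components_inside //; apply/bigcupP/idP.
  move=> [_ /imsetP[z zW ->]]; exact/subsetP/component_min.
by move=> xW; exists (component A x); rewrite ?imset_f ?mem_component.
Qed.

(** Adding an edge merges the components of its endpoints and leaves the others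
    alone. If the endpoints were already connected then the two components
    coincide and nothing changes. *)
Lemma component_add A u v (K := component A u :|: component A v) x :
  component ((u, v) |: A) x = if x \in K then K else component A x.
Proof.
have sub z w : connect (adj A) z w -> connect (adj ((u, v) |: A)) z w.
  apply: connect_sub => {}z {}w zw; apply: connect1; move: zw.
  by rewrite /adj !inE => /orP[] ->; rewrite !orbT.
have csym := sym_connect_sym (@adj_sym ((u, v) |: A)).
have uv : connect (adj ((u, v) |: A)) u v.
  by apply: connect1; rewrite /adj !inE eqxx.
have uK w : w \in K -> connect (adj ((u, v) |: A)) u w.
  rewrite !inE => /orP[] /sub //; exact: connect_trans.
apply/eqP; rewrite eqEsubset; apply/andP; split.
  case: ifP => xK.
    apply: component_min => // f /setU1P[->|fA] /=.
      by rewrite !in_setU !mem_component orbT.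
    by rewrite !in_setU !(component_closed _ fA).
  apply: component_min; rewrite ?mem_component // =>
    f /setU1P[->|/component_closed //] /=.
  have csA := sym_connect_sym (@adj_sym A).
  by move: xK; rewrite !inE !(csA x) => /norP[/negPf-> /negPf->].
apply/subsetP => y; case: ifP => [xK yK|_]; rewrite !inE; last exact: sub.
by apply: connect_trans (uK _ yK); rewrite csym uK.
Qed.

(** * Orientations of a tree *)

(** A path avoiding the edge between [u] and [v] would close up to a cycle
    through this edge. *)
Lemma tree_connect (r : rel V) u v :
  is_tree e -> subrel r e -> e u v -> connect r u v -> r u v.
Proof.
case=> e_sym e_irr _ _ e_cyc re uv /connectP[p0 p0r].
case: (shortenP p0r) => p pr p_uniq _ {p0 p0r} pv.
case: p => [|w [|w' p]] /= in pr p_uniq pv *.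
- by move: uv; rewrite pv e_irr.
- by move: pr; rewrite andbT -pv.
have /e_cyc : ucycle e [:: u, w, w' & p] by
  rewrite /ucycle /= rcons_path -pv (e_sym v) uv andbT;
  case/and3P: pr p_uniq => /re -> /re -> /(sub_path re) ->.
by [].
Qed.

Lemma mem_edges_asym x y :
  is_tree e -> e x y -> ((y, x) \in edges) = ((x, y) \notin edges).
Proof.
case=> e_sym e_irr _ _ _ xy; rewrite !inE /= e_sym xy /= -leqNgt [RHS]leq_eqVlt.
case: eqP => // /ord_inj/enum_rank_inj yx.
by move: xy; rewrite yx e_irr.
Qed.

Lemma mem_edges_rel x y : (x, y) \in edges -> e x y.
Proof. by rewrite inE => /andP[]. Qed.

(** The orientation keeping the reference direction of the edges in [A] and
    reversing the other edges. *)
Definition orient (A : {set V * V}) : {set V * V} :=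
  [set f | (f \in A) || ((f.2, f.1) \in edges :\: A)].

Lemma orientE (A : {set V * V}) x y :
  ((x, y) \in orient A) =
  ((x, y) \in A) || ((y, x) \in edges) && ((y, x) \notin A).
Proof. by rewrite [LHS]in_set /= in_setD andbC. Qed.

Lemma mem_orient (A : {set V * V}) x y :
  is_tree e -> A \subset edges -> (x, y) \in edges ->
  ((x, y) \in orient A = ((x, y) \in A))
  * ((y, x) \in orient A = ((x, y) \notin A)).
Proof.
move=> tree_e /subsetP AE xyE.
have yxE : (y, x) \notin edges.
  by rewrite (mem_edges_asym tree_e (mem_edges_rel xyE)) xyE.
have yxA : (y, x) \notin A by apply: contra yxE => /AE.
by rewrite !orientE xyE (negPf yxE) (negPf yxA) orbF.
Qed.

Lemma sum_orientations (R : nmodType) (F : {set V * V} -> R) :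
  is_tree e ->
  \sum_(D | orientation e D) F D =
  \sum_(A : {set V * V} | A \subset edges) F (orient A).
Proof.
move=> tree_e; have [e_sym _ _ _ _] := tree_e.
rewrite (reindex_onto orient (fun D => D :&: edges)) /= => [|D /forallP oD].
  apply: eq_bigl => A; apply/andP/idP => [[_ /eqP <-]|AE].
    exact: subsetIr.
  split.
    apply/forallP => x; apply/forallP => y; rewrite /Defs.arc /=.
    have [xy|nxy] := ifPn.
      have [xyE|] := boolP ((x, y) \in edges).
        by rewrite !(mem_orient tree_e AE xyE) //; case: (_ \in A).
      rewrite -(mem_edges_asym tree_e xy) => yxE.
      by rewrite !(mem_orient tree_e AE yxE) //; case: (_ \in A).
    rewrite orientE.
    apply: contra nxy => /orP[/(subsetP AE)/mem_edges_rel //|].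
    by rewrite e_sym => /andP[/mem_edges_rel].
  apply/eqP/setP => -[x y]; rewrite in_setI; apply/andP/idP => [[xyD xyE]|xyA].
    by rewrite -(mem_orient tree_e AE xyE).
  have xyE := subsetP AE _ xyA.
  by rewrite (mem_orient tree_e AE xyE).
apply/setP => -[x y]; have /forallP/(_ y) := oD x; rewrite /Defs.arc /=.
rewrite orientE !in_setI.
have [xy|nxy] := ifPn.
  rewrite (mem_edges_asym tree_e xy); case: (_ \in edges);
    by case: ((x, y) \in D); case: ((y, x) \in D).
move/negPf->; apply/negP => /andP[/mem_edges_rel].
by rewrite e_sym (negPf nxy).
Qed.

(** A directed path from [y] to [x] must be the single arc from [y] to [x] by
    [tree_connect], but the edge is already directed from [x] to [y]. *)
Lemma orientation_acyclic D : is_tree e -> orientation e D -> acyclic D.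
Proof.
move=> tree_e /forallP oD; have [e_sym _ _ _ _] := tree_e.
have {}oD x y := forallP (oD x) y.
have De : subrel (Defs.arc D) e.
  by move=> x y xyD; have := oD x y; rewrite xyD; case: ifP.
apply/forallP => x; apply/forallP => y; apply/implyP => xyD; apply/negP.
move=> /(tree_connect tree_e De); rewrite e_sym (De _ _ xyD) => /(_ isT) yxD.
by have := oD x y; rewrite (De _ _ xyD) xyD yxD.
Qed.

Lemma sub_sinks_orient (A : {set V * V}) (W : {set V}) :
  is_tree e -> A \subset edges ->
  (W \subset sinks (orient A)) =
  [forall f in edges, if f \in A then f.1 \notin W else f.2 \notin W].
Proof.
move=> tree_e AE; apply/subsetP/forall_inP => [WA [x y] xyE|WA x xW].
  have [xyO yxO] := mem_orient tree_e AE xyE.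
  case: ifP => xyA; apply/negP => /WA; rewrite inE => /forallP.
    by move=> /(_ y); rewrite /Defs.arc /= xyO xyA.
  by move=> /(_ x); rewrite /Defs.arc /= yxO xyA.
rewrite inE; apply/forallP => y; rewrite /Defs.arc /= orientE.
apply/norP; split.
  apply/negP => xyA; have := WA _ (subsetP AE _ xyA).
  by rewrite xyA xW.
by apply/negP => /andP[/WA /= yxE /negPf yxA]; move: yxE; rewrite yxA xW.
Qed.

(** Expand each power by choosing a set [W] of sinks. An edge can be directed in
    two ways, each of which is allowed when its tail is outside [W], and these
    choices are independent. *)
Lemma sum_orientations_sinks (R : comPzRingType) (y : R) :
  is_tree e ->
  \sum_(D | orientation e D) (1 - y) ^+ #|sinks D| =
  \sum_(W : {set V}) (- y) ^+ #|W| *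
    \prod_(f in edges) ((f.1 \notin W)%:R + (f.2 \notin W)%:R).
Proof.
move=> tree_e; rewrite sum_orientations //.
under eq_bigr => A _.
  rewrite -prodr_const prod_one_add_subsets.
  under eq_bigr do rewrite prodr_const.
  rewrite big_mkcond /=.
  over.
rewrite exchange_big /=; apply: eq_bigr => W _.
rewrite prod_add_subsets mulr_sumr; apply: eq_bigr => A AE.
rewrite (sub_sinks_orient W tree_e AE).
under [in RHS]eq_bigr do rewrite -(fun_if (fun b : bool => b%:R)).
by rewrite prod_indicator; case: ifP => _; rewrite ?mulr1 ?mulr0.
Qed.

(** * Connected partitions of a tree *)

Lemma sub_adj (A : {set V * V}) :
  is_tree e -> A \subset edges -> subrel (adj A) e.
Proof.
case=> e_sym _ _ _ _ /subsetP AE x y /orP[] /AE/mem_edges_rel //.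
by rewrite e_sym.
Qed.

Lemma component_connected (A : {set V * V}) x :
  is_tree e -> A \subset edges -> connected_in e (component A x).
Proof.
move=> tree_e AE; apply/forall_inP => y yC; apply/forall_inP => z zC.
have : connect (adj A) y z by rewrite -eq_component; move: yC zC;
  rewrite !inE -!eq_component => /eqP <- /eqP <-.
case/connectP=> p pA {zC} ->; elim: p y yC pA => //= w p IHp y yC /andP[yw wp].
have wC : w \in component A x.
  by move: yC; rewrite !inE => /connect_trans; apply; apply: connect1.
apply: connect_trans (IHp _ wC wp); apply: connect1.
by rewrite /induced /= yC wC (sub_adj tree_e AE).
Qed.

Definition inner_edges (P : {set {set V}}) : {set V * V} :=
  [set f in edges | f.2 \in pblock P f.1].

Lemma pblock_components (A : {set V * V}) x :
  pblock (components A) x = component A x.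
Proof.
have /and3P[_ tiA _] := components_partition A.
exact: def_pblock tiA (mem_components A x) (mem_component A x).
Qed.

Lemma components_inner_edges (P : {set {set V}}) :
  is_tree e -> connected_partition e P -> components (inner_edges P) = P.
Proof.
move=> tree_e /andP[partP /forall_inP connP].
have /and3P[/eqP coverP tiP P0] := partP.
have inP x : x \in cover P by rewrite coverP inE.
have compE x : component (inner_edges P) x = pblock P x.
  apply/eqP; rewrite eqEsubset; apply/andP; split.
    apply: component_min => [|f]; first by rewrite mem_pblock.
    rewrite inE => /andP[_ fP].
    by rewrite -!eq_pblock // (same_pblock tiP fP).
  have BP := pblock_mem (inP x).
  have /forall_inP/(_ x) := connP _ BP.
  rewrite mem_pblock => /(_ (inP x))/forall_inP xB.
  apply/subsetP => y /xB; rewrite inE; apply: connect_sub => z w /and3P[zB wB zw].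
  apply: connect1; rewrite /adj; have zE := def_pblock tiP BP zB.
  have wE := def_pblock tiP BP wB.
  have [zwE|] := boolP ((z, w) \in edges); first by rewrite inE zwE zE wB.
  rewrite -(mem_edges_asym tree_e zw) => wzE.
  by rewrite [X in _ || X]inE wzE wE zB orbT.
apply/setP => B; apply/imsetP/idP => [[x _ ->]|BP].
  by rewrite compE pblock_mem.
have [B0|[x xB]] := set_0Vmem B; first by rewrite -B0 BP in P0.
by exists x => //; rewrite compE (def_pblock tiP BP xB).
Qed.

(** This is where cycles would be an obstruction: an edge whose endpoints are in
    the same component of [A] has to belong to [A]. *)
Lemma inner_edges_components (A : {set V * V}) :
  is_tree e -> A \subset edges -> inner_edges (components A) = A.
Proof.
move=> tree_e AE; apply/setP => -[x y]; rewrite inE pblock_components.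
rewrite [X in _ && X]inE /=.
apply/andP/idP => [[xyE]|xyA]; last first.
  by split; [apply: (subsetP AE) | apply: connect1; rewrite /adj xyA].
have xy := mem_edges_rel xyE.
move=> /(tree_connect tree_e (sub_adj tree_e AE) xy) /orP[//|/(subsetP AE)].
by rewrite (mem_edges_asym tree_e xy) xyE.
Qed.

Lemma sum_connected_partitions (R : nmodType) (F : {set {set V}} -> R) :
  is_tree e ->
  \sum_(P | connected_partition e P) F P =
  \sum_(A : {set V * V} | A \subset edges) F (components A).
Proof.
move=> tree_e; rewrite (reindex_onto components inner_edges) /= => [|P cP].
  apply: eq_bigl => A; apply/andP/idP => [[_ /eqP <-]|AE].
    by apply/subsetP => f; rewrite inE => /andP[].
  rewrite inner_edges_components // eqxx; split=> //.
  rewrite /connected_partition components_partition; apply/forall_inP.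
  by move=> _ /imsetP[x _ ->]; apply: component_connected.
exact: components_inner_edges.
Qed.

(** The count of vertices, edges and components of a forest, restricted to a
    union [W] of components. Edges are added one at a time; as there is no
    cycle, an edge inside [W] merges two distinct components, and an edge
    outside [W] leaves both terms of the sum unchanged. *)
Lemma card_components_inside (A : {set V * V}) (W : {set V}) :
  is_tree e -> A \subset edges ->
  (forall f, f \in A -> (f.1 \in W) = (f.2 \in W)) ->
  (#|component A @: W| + #|[set f in A | f.1 \in W]| = #|W|)%N.
Proof.
move=> tree_e; move: {2}#|A| (leqnn #|A|) => m.
elim: m A => [|m IHm] A Am AE WA.
  have {Am} A0 : A = set0 by apply/eqP; rewrite -cards_eq0 -leqn0.
  rewrite A0 in WA *; rewrite [X in (_ + X)%N](_ : _ = 0%N) ?addn0; last first.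
    by apply/eqP; rewrite cards_eq0; apply/eqP/setP => f; rewrite !inE.
  apply: card_imset => x y /eqP; rewrite eq_component => /connectP[[|z p] //=].
  by rewrite /adj !inE.
have [A0|[[u v] fA]] := set_0Vmem A.
  by apply: IHm => //; rewrite A0 cards0.
set A' := A :\ (u, v).
have AA' : A = (u, v) |: A' by rewrite setD1K.
have A'A : A' \subset A by apply: subsetDl.
have {}IHm : (#|component A' @: W| + #|[set f in A' | f.1 \in W]| = #|W|)%N.
  apply: IHm; last by move=> f /(subsetP A'A)/WA.
    by rewrite -ltnS (leq_trans _ Am) // [in leqRHS](cardsD1 (u, v)) fA.
  exact: subset_trans AE.
have xyE := subsetP AE _ fA.
have nuv : ~~ connect (adj A') u v.
  apply/negP => /(tree_connect tree_e (sub_adj tree_e (subset_trans A'A AE))).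
  move=> /(_ (mem_edges_rel xyE)); rewrite /adj !inE eqxx /= => /andP[_].
  move=> /(subsetP AE).
  by rewrite (mem_edges_asym tree_e (mem_edges_rel xyE)) xyE.
set K := component A' u :|: component A' v.
have compE x : component A x = if x \in K then K else component A' x.
  by rewrite AA' component_add.
have uvW : (u \in W) = (v \in W) := WA _ fA.
have WA' f : f \in A' -> (f.1 \in W) = (f.2 \in W) by move/(subsetP A'A)/WA.
have subW x : x \in W -> component A' x \subset W.
  by move=> xW; apply: component_min.
have csym := sym_connect_sym (@adj_sym A').
have [uW|uW] := boolP (u \in W); last first.
  have xK x : x \in W -> x \notin K.
    move=> /subW/subsetP xW; rewrite !inE ![connect _ _ x]csym.
    apply/norP; split; first by apply: contra uW => xu; rewrite xW // inE.
    by apply: contra uW => xv; rewrite uvW xW // inE.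
  rewrite -IHm; congr (_ + _)%N.
    congr #|pred_of_set _|; apply: eq_in_imset => x xW.
    by rewrite compE (negPf (xK x xW)).
  congr #|pred_of_set _|; apply/setP => f; rewrite AA' !inE.
  by case: eqP => // -> /=; rewrite (negPf uW).
have vW : v \in W by rewrite -uvW.
have KW : K \subset W by rewrite subUset !subW.
(* [Z] collects the components in [W] that are left alone by the new edge. *)
set Z := component A' @: (W :\: K).
have ZP x : x \in K -> component A' x \notin Z.
  move=> xK; apply/imsetP => -[z]; rewrite inE => /andP[zK _] /eqP.
  rewrite eq_component => xz; case/negP: zK; move: xK.
  by rewrite !inE => /orP[] /connect_trans /(_ xz) ->; rewrite ?orbT.
have KZ : K \notin Z.
  apply/imsetP => -[z]; rewrite inE => /andP[zK _] Kz.
  by move: zK; rewrite Kz mem_component.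
have uK : u \in K by rewrite in_setU mem_component.
have vK : v \in K by rewrite in_setU mem_component orbT.
have WE : W = K :|: (W :\: K).
  by rewrite setDE setUIr setUCr setIT; apply/esym/setUidPr.
have -> : component A @: W = K |: Z.
  rewrite WE imsetU; congr (_ :|: _).
    apply/setP => B; rewrite inE; apply/imsetP/eqP => [[x xK ->]|->].
      by rewrite compE xK.
    by exists u; rewrite // compE uK.
  by apply: eq_in_imset => x; rewrite inE compE => /andP[/negPf->].
have A'W : component A' @: W = component A' u |: (component A' v |: Z).
  rewrite WE imsetU setUA; congr (_ :|: _).
  apply/setP => B; rewrite !inE; apply/imsetP/orP => [[x xK ->]|].
    by move: xK; rewrite !inE -!eq_component => /orP[]/eqP->;
      rewrite eqxx; [left|right].
  by case=> /eqP ->; [exists u|exists v].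
rewrite cardsU1 KZ -IHm A'W !cardsU1 !inE ZP // negb_or ZP // eq_component nuv /=.
have -> : [set f in A | f.1 \in W] = (u, v) |: [set f in A' | f.1 \in W].
  apply/setP => f; rewrite AA' !inE.
  by case: eqP => // -> /=.
by rewrite cardsU1 !inE eqxx /= addnA addn1.
Qed.

(** Once the sign is expressed by [card_components_inside], an edge of [A]
    contributes [-1], [0] or [1] according to whether two, one or none of its
    endpoints are in [W]. An edge outside [A] contributes [1]; the sum of the
    two contributions is the number of endpoints outside [W]. *)
Lemma sum_connected_partitions_blocks (R : comPzRingType) (y : R) :
  is_tree e ->
  \sum_(P | connected_partition e P) \prod_(B in P) (1 - y ^+ #|B|) =
  \sum_(W : {set V}) (- y) ^+ #|W| *
    \prod_(f in edges) ((f.1 \notin W)%:R + (f.2 \notin W)%:R).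
Proof.
move=> tree_e; rewrite sum_connected_partitions //.
under eq_bigr => A _.
  rewrite (prod_blocks_saturated y (components_partition A)) big_mkcond /=.
  over.
rewrite exchange_big /=; apply: eq_bigr => W _.
(* The contribution of an edge that is kept in [A]. *)
pose h (f : V * V) : R := (f.1 \notin W)%:R + (f.2 \notin W)%:R - 1.
rewrite (eq_bigr (fun f => 1 + h f)) => [|f _]; last first.
  by rewrite /h [RHS]addrC subrK.
rewrite prod_one_add_subsets mulr_sumr; apply: eq_bigr => A AE.
case: ifPn => [/saturated_components WA|/saturated_components nWA].
  rewrite (eq_bigr (fun f => if f.1 \in W then -1 else 1)) => [|f fA]; last first.
    by rewrite /h (WA f fA); case: (_ \in W); rewrite /= ?add0r ?addrK.
  rewrite -big_mkcondr /= components_inside //.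
  rewrite (eq_bigl (mem [set f in A | f.1 \in W])) => [|f]; last by rewrite !inE.
  rewrite prodr_const [(- y) ^+ _]exprNn mulrAC; congr (_ * _).
  rewrite -[in RHS](card_components_inside tree_e AE WA) exprD -mulrA -exprMn.
  by rewrite mulrNN mulr1 expr1n mulr1.
suff /existsP[f /andP[fA fW]] : [exists f in A, (f.1 \in W) != (f.2 \in W)].
  rewrite (bigD1 f) //= [h f](_ : _ = 0) ?mul0r ?mulr0 //.
  by rewrite /h; move: fW; case: (f.1 \in W); case: (f.2 \in W);
    rewrite //= ?add0r ?addr0 subrr.
apply: contraT; rewrite negb_exists => /forallP WA; case: nWA => f fA.
by have := WA f; rewrite fA negbK => /eqP.
Qed.

End Edges.

(** * The theorem *)

Lemma sum_connected_partitions_type (V : finType) (e : rel V) n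
    (R : comPzSemiRingType) (F : nat -> R) :
  #|V| = n ->
  \sum_(P | connected_partition e P) \prod_(B in P) F #|B| =
  \sum_(mu : intpart n)
     (num_connected_partitions e mu)%:R * \prod_(m <- parts mu) F m.
Proof.
move=> Vn; pose typ (P : {set {set V}}) := [seq #|B| | B : {set V} in P].
have typP P : connected_partition e P ->
    exists p : intpart n, forall q : intpart n, has_type P q = (q == p).
  move=> /andP[partP _]; have /and3P[_ _ P0] := partP.
  apply: (@intpart_of_perm n (typ P)).
    apply/imageP => -[B BP /esym/eqP]; rewrite cards_eq0 => /eqP B0.
    by rewrite -B0 BP in P0.
  by rewrite sumnE big_image /= -Vn -cardsT (card_partition partP).
transitivity (\sum_(P | connected_partition e P)
    \sum_(mu : intpart n | has_type P mu) \prod_(m <- parts mu) F m).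
  apply: eq_bigr => P /typP[p pP]; rewrite (big_pred1 p) //.
  have : has_type P p by rewrite pP.
  by rewrite /has_type => /(perm_big _) <-; rewrite big_image.
rewrite (exchange_big_dep predT) //=; apply: eq_bigr => mu _.
rewrite (eq_bigl (mem [set P | connected_partition e P && has_type P mu])).
  by rewrite sumr_const mulr_natl.
by move=> P; rewrite !inE.
Qed.

Theorem theorem2p6 (V : finType) (e : rel V) (n j : nat) :
  is_tree e -> #|V| = n -> (0 < j)%N ->
  (num_sink_orientations e j)%:Z =
    \sum_(lam : intpart n | size lam == j)
      \sum_(mu : intpart n | refines mu lam)
        (-1) ^+ (j - size mu)%N
          * (num_connected_partitions e mu)%:Z * (brick_weight lam mu)%:Z.
Proof.
move=> tree_e Vn _.
(* Acyclicity is automatic in a tree, so it disappears from the count. *)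
have sinksE : (num_sink_orientations e j)%:Z =
    (\sum_(D | orientation e D) 'X^#|sinks D| : {poly int})`_j.
  rewrite coef_sum /num_sink_orientations -sum1_card.
  rewrite (big_morph Posz PoszD erefl) big_mkcond [RHS]big_mkcond /=.
  apply: eq_bigr => D _; rewrite inE coefXn eq_sym.
  have [oD|//] := boolP (orientation e D).
  by rewrite (orientation_acyclic tree_e oD) eq_sym; case: eqP.
rewrite sinksE.
rewrite (eq_bigr (fun D => (1 - (1 - 'X)) ^+ #|sinks D|)) => [|D _]; last first.
  by rewrite subKr.
rewrite sum_orientations_sinks // -sum_connected_partitions_blocks //.
rewrite (sum_connected_partitions_type e (fun m => 1 - (1 - 'X) ^+ m) Vn).
rewrite coef_sum.
under eq_bigr do rewrite mulr_natl coefMn coef_prod_bricks -mulr_natl mulr_sumr.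
rewrite [RHS](exchange_big_dep predT) //=; apply: eq_bigr => mu _.
by apply: eq_bigr => lam _; rewrite natz mulrCA mulrA.
Qed.
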